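(* Let $q>1$, $\varepsilon>0$ and let $\phi_0\in C_c^\infty(\mathbb{R})$ be of the form $$\phi_0(x)=\begin{cases}1 & \text{for }|x|\le\varepsilon,\\ \eta(|x|) & \text{for }|x|\in(\varepsilon,\varepsilon q],\\ 0 & \text{for }|x|>\varepsilon q,\end{cases}$$ where $\eta\in C^\infty([\varepsilon,q\varepsilon])$ is chosen so that $\phi_0\in C^\infty(\mathbb{R})$. Then the function $\psi=\prod_{m=0}^\infty\left(\mathrm{Id}-q^{-(m+1)}D_{1/q}\right)\phi_0$ has the explicit representation $$\psi(x)=\varphi\left(\tfrac1q\right)+\sum_{\ell=0}^\infty\left[\frac{1}{(q;q)_\ell}\cdot\eta\left(\frac{|x|}{q^\ell}\right)-\sum_{k=0}^\ell\frac{1}{(q;q)_k}\right]\cdot\mathbf{1}_{(\varepsilon q^\ell,\,\varepsilon q^{\ell+1}]}(|x|),\qquad x\in\mathbb{R}.$$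
   Context: For $a>0$, $D_a$ is the dilation operator $D_af(x)=f(ax)$ and $\mathrm{Id}$ is the identity operator. The infinite product denotes the uniform limit $\psi=\lim_{m\to\infty}\phi_m$ of the sequence defined recursively by $\phi_{m+1}=\left(\mathrm{Id}-q^{-(m+1)}D_{1/q}\right)\phi_m$, $m=0,1,2,\ldots$. The q-Pochhammer symbol is $(a;q)_n=\prod_{k=0}^{n-1}(1-aq^k)$, so $(q;q)_\ell=\prod_{k=1}^\ell(1-q^k)$ and $(q;q)_0=1$. For $|x|<1$, $\varphi(x)=\prod_{k=1}^\infty(1-x^k)$ is Euler's function. $\mathbf{1}_A$ is the indicator function of $A$; a summand is understood to be $0$ where its indicator function vanishes. *)

(* Defs.v *)
From HB Require Import structures.
From mathcomp Require Export all_boot all_order all_algebra.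
From mathcomp Require Export all_classical all_reals all_analysis.
Export Order.TTheory GRing.Theory Num.Theory.
Export numFieldNormedType.Exports.

Set Implicit Arguments.
Unset Strict Implicit.
Unset Printing Implicit Defensive.

Local Open Scope classical_set_scope.
Local Open Scope ring_scope.

Definition smooth (R : realType) (f : R -> R) : Prop :=
  forall (n : nat) (x : R), derivable (f^`(n))%classic x 1.

Definition compactly_supported (R : realType) (f : R -> R) : Prop :=
  compact (closure [set x | f x != 0]).

(* g n is the n-th derivative of f relative to [a, b]: the difference quotients
   only involve points of [a, b], hence are one-sided at a and b. The values of
   f outside [a, b] are irrelevant. *)
Definition smooth_segment (R : realType) (a b : R) (f : R -> R) : Prop :=
  exists g : nat -> R -> R,
    {in `[a, b], g 0%N =1 f} /\
    forall n : nat, {in `[a, b], forall x : R,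
      (g n y - g n x) / (y - x) @[y --> within `[a, b] (dnbhs x)] --> g n.+1 x}.

Definition dilation (R : realType) (a : R) (f : R -> R) : R -> R :=
  fun x => f (a * x).

Fixpoint dilation_iter (R : realType) (q : R) (f : R -> R) (m : nat) : R -> R :=
  if m is m'.+1 then
    fun x => dilation_iter q f m' x
             - q ^- m'.+1 * dilation q^-1 (dilation_iter q f m') x
  else f.

(* The uniform limit on the whole line; only meaningful when it exists, in which
   case it is unique. *)
Definition dilation_product (R : realType) (q : R) (f : R -> R) : R -> R :=
  get [set g : R -> R | {uniform, dilation_iter q f @ \oo --> g}].

Definition q_pochhammer (R : realType) (a q : R) (n : nat) : R :=
  \prod_(0 <= k < n) (1 - a * q ^+ k).

Definition euler_function (R : realType) (x : R) : R :=
  limn (fun n : nat => \prod_(1 <= k < n.+1) (1 - x ^+ k)).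

(* Main.v *)
(* By the q-binomial theorem phi_m(x) = \sum_(j <= m) c(m, j) phi0(x / q^j), where
   c(m, j) --> 1 / (q; q)_j as m grows. Applied to the constant 1, the same
   formula gives \sum_(j <= m) c(m, j) = \prod_(1 <= k <= m) (1 - q^-k), which
   tends to the Euler function at 1 / q. Subtracting, phi_m(x) minus this product
   is \sum_j c(m, j) (phi0(x / q^j) - 1), a sum whose terms vanish as soon as
   |x| <= eps q^j, so that the limit can be taken term by term and no summation
   of the infinite series of the 1 / (q; q)_j is needed. *)
Require Import Defs.
From mathcomp Require Import ring lra.

Set Implicit Arguments.
Unset Strict Implicit.
Unset Printing Implicit Defensive.

Local Open Scope classical_set_scope.
Local Open Scope ring_scope.

Section DilationProduct.
Context {R : realType} {q : R}.
Hypothesis q_gt1 : 1 < q.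
Implicit Types (f : R -> R) (x : R) (j m n : nat).

Let q_gt0 : 0 < q. Proof. exact: lt_trans q_gt1. Qed.
Let q_neq0 : q != 0. Proof. by rewrite gt_eqF. Qed.
Let invq_ge0 : 0 <= q^-1. Proof. by rewrite invr_ge0 ltW. Qed.
Let exprV_ge0 n : 0 <= q ^- n. Proof. by rewrite -exprVn exprn_ge0. Qed.
Let invq_lt1 : q^-1 < 1. Proof. by rewrite invf_lt1. Qed.

Lemma q_pochhammerS j :
  q_pochhammer q q j.+1 = q_pochhammer q q j * (1 - q ^+ j.+1).
Proof. by rewrite /q_pochhammer big_nat_recr//= -exprS. Qed.

Lemma subr_exprS_neq0 j : 1 - q ^+ j.+1 != 0.
Proof. by rewrite subr_eq0 lt_eqF// exprn_egt1. Qed.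

Lemma q_pochhammer_neq0 j : q_pochhammer q q j != 0.
Proof.
elim: j => [|j IH]; first by rewrite /q_pochhammer big_nil oner_eq0.
by rewrite q_pochhammerS mulf_neq0// subr_exprS_neq0.
Qed.

(* The coefficient of z ^+ j in \prod_(1 <= k < m.+1) (1 - q ^- k * z); the
   truncated subtraction makes it vanish for j > m. *)
Definition dilation_coef m j : R :=
  (q_pochhammer q q j)^-1 * \prod_(0 <= i < j) (1 - q ^- (m - i)).

Lemma dilation_coef0 m : dilation_coef m 0 = 1.
Proof. by rewrite /dilation_coef /q_pochhammer !big_nil invr1 mulr1. Qed.

Lemma dilation_coef_small m j : (m < j)%N -> dilation_coef m j = 0.
Proof.
move=> mj; rewrite /dilation_coef (bigD1_seq m) ?mem_index_iota ?iota_uniq//=.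
by rewrite subnn expr0 invr1 subrr mul0r mulr0.
Qed.

(** A q-Pascal rule. All three coefficients share the product [P]; with Q = q^-(m+1), what remains
    is 1 - Q = (1 - Q q^(j+1)) - Q (1 - q^(j+1)). *)
Lemma dilation_coefS m j : dilation_coef m.+1 j.+1 =
  dilation_coef m j.+1 - q ^- m.+1 * dilation_coef m j.
Proof.
have [jm|mj] := leqP j m; last first.
  by rewrite !dilation_coef_small ?mulr0 ?subr0// ltnW.
rewrite /dilation_coef big_nat_recl//= subn0 big_nat_recr//= q_pochhammerS.
under eq_bigr do rewrite subSS.
set P := \prod_(0 <= i < j) _.
have -> : q ^- (m - j) = q ^- m.+1 * q ^+ j.+1.
  by rewrite -subSS expfB_cond ?(negPf q_neq0)//= invf_div mulrC.
by field; rewrite expf_neq0//= subr_exprS_neq0 q_pochhammer_neq0.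
Qed.

Lemma dilation_iterE f m x : dilation_iter q f m x =
  \sum_(0 <= j < m.+1) dilation_coef m j * f (x / q ^+ j).
Proof.
elim: m x => [|m IH] x.
  by rewrite big_nat1 dilation_coef0 mul1r expr0 divr1.
rewrite big_nat_recl//= /dilation !IH dilation_coef0.
under [X in _ = _ + X]eq_bigr => j _ do rewrite dilation_coefS mulrBl.
rewrite sumrB addrA; congr (_ - _); last first.
  rewrite mulr_sumr; apply: eq_bigr => j _.
  by rewrite mulrA; congr (_ * f _); rewrite exprS; field; rewrite expf_neq0.
(* The ranges differ by the index m+1, whose coefficient at stage m is zero. *)
rewrite [in LHS]big_nat_recl// big_nat_recr//= (@dilation_coef_small m m.+1)//.
by rewrite dilation_coef0 mul0r addr0.
Qed.

Lemma cvg_dilation_coef j :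
  dilation_coef ^~ j @ \oo --> (q_pochhammer q q j)^-1.
Proof.
rewrite -[X in _ --> X]mulr1; apply: cvgM; first exact: cvg_cst.
rewrite -[X in _ --> X](_ : \prod_(0 <= i < j) 1 = _); last by rewrite big1.
apply: cvg_big => [|i _]; first exact: mul_continuous.
rewrite -[X in _ --> X]subr0; apply: cvgB; first exact: cvg_cst.
(* Shifting m by i removes the truncated subtraction and leaves a geometric sequence. *)
rewrite -(cvg_shiftn i) /=; under eq_fun do rewrite addnK -exprVn.
by apply: cvg_expr; rewrite ger0_norm.
Qed.

Lemma dilation_iter_cst1 m x :
  dilation_iter q (cst 1) m x = \prod_(1 <= k < m.+1) (1 - q^-1 ^+ k).
Proof.
elim: m x => [|m IH] x; first by rewrite big_nil.
by rewrite /= /dilation !IH [RHS]big_nat_recr//= exprVn mulrBr mulr1 mulrC.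
Qed.

Lemma cvg_euler_function :
  (fun n => \prod_(1 <= k < n.+1) (1 - q^-1 ^+ k)) @ \oo -->
  euler_function (1 / q).
Proof.
rewrite /euler_function div1r.
have t0 k : 0 <= 1 - q^-1 ^+ k by rewrite subr_ge0 exprn_ile1// ltW.
have P0 n : 0 <= \prod_(1 <= k < n.+1) (1 - q^-1 ^+ k) by apply: prodr_ge0.
apply: nonincreasing_is_cvgn; last by exists 0 => _ [n _ <-].
apply/nonincreasing_seqP => n; rewrite [leLHS]big_nat_recr//=.
by rewrite ler_piMr// gerBl exprn_ge0.
Qed.

Lemma cvg_dilation_iter f x N :
  (forall j, (N <= j)%N -> f (x / q ^+ j) = 1) ->
  dilation_iter q f m x @[m --> \oo] --> euler_function (1 / q) +
    \sum_(0 <= j < N) (q_pochhammer q q j)^-1 * (f (x / q ^+ j) - 1).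
Proof.
move=> f1.
have -> : dilation_iter q f ^~ x = fun m =>
    \prod_(1 <= k < m.+1) (1 - q^-1 ^+ k) +
    \sum_(0 <= j < N) dilation_coef m j * (f (x / q ^+ j) - 1).
  apply/funext => m; rewrite -(dilation_iter_cst1 m x) !dilation_iterE.
  apply/eqP; rewrite addrC -subr_eq -sumrB; apply/eqP.
  under eq_bigr do rewrite -mulrBr.
  (* The sums up to m and up to N agree: surplus terms have a zero coefficient if m < N, and a zero
     factor f - 1 by [f1] otherwise. *)
  have [mN|Nm] := leqP m.+1 N.
    rewrite [RHS](big_cat_nat (n := m.+1))//= [X in _ + X]big_nat.
    rewrite [X in _ + X]big1 ?addr0// => j /andP[mj _].
    by rewrite dilation_coef_small// mul0r.
  rewrite (big_cat_nat (n := N) _ (ltnW Nm))//= [X in _ + X]big_nat.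
  rewrite [X in _ + X]big1 ?addr0// => j /andP[Nj _].
  by rewrite f1// subrr mulr0.
apply: cvgD; first exact: cvg_euler_function.
apply: cvg_big => [|j _]; first exact: add_continuous.
by apply: cvgM; [exact: cvg_dilation_coef|exact: cvg_cst].
Qed.

(** The geometric sum of the q^-i for i < n, in closed form so that its uniform bound is
    immediate. *)
Let geo n : R := (1 - q^-1 ^+ n) / (1 - q^-1).

Let geoS n : geo n.+1 = geo n + q^-1 ^+ n.
Proof.
rewrite /geo exprS; field.
by rewrite q_neq0 subr_eq0 gt_eqF.
Qed.

Let geo_le n : geo n <= (1 - q^-1)^-1.
Proof.
by rewrite ler_pdivrMr ?subr_gt0// mulVf ?gt_eqF ?subr_gt0// gerBl exprn_ge0.
Qed.

(** Step m multiplies the bound by at most 1 + q^-(m+1) <= exp(q^-(m+1)), and these exponents have a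
    convergent sum. *)
Lemma dilation_iter_bounded f M : (forall x, `|f x| <= M) ->
  exists B, forall m x, `|dilation_iter q f m x| <= B.
Proof.
move=> fM; have M0 : 0 <= M := le_trans (normr_ge0 _) (fM 0).
exists (M * expR (1 - q^-1)^-1) => m x.
suff: `|dilation_iter q f m x| <= M * expR (geo m.+1).
  by move/le_trans; apply; rewrite ler_wpM2l// ler_expR.
elim: m x => [|m IH] x /=.
  by rewrite (le_trans (fM x))// ler_peMr// -[leLHS]expR0 ler_expR /geo expr1 divff//
    gt_eqF// subr_gt0.
rewrite geoS expRD mulrA (le_trans (ler_normB _ _))//.
rewrite normrM (ger0_norm (exprV_ge0 _)).
apply: (@le_trans _ _ (M * expR (geo m.+1) * (1 + q^-1 ^+ m.+1))).
  by rewrite mulrDr mulr1 lerD// mulrC exprVn ler_wpM2r//; exact: IH.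
by rewrite ler_wpM2l ?mulr_ge0 ?expR_ge0// expR_ge1Dx.
Qed.

(* Each step changes the function by at most q ^- m.+1 * B, so the sequence is
   uniformly Cauchy, at a geometric rate. *)
Lemma uniform_dilation_iter f (g : R -> R) M : (forall x, `|f x| <= M) ->
  (forall x, dilation_iter q f m x @[m --> \oo] --> g x) ->
  {uniform, dilation_iter q f @ \oo --> g}.
Proof.
move=> /dilation_iter_bounded[B fB] fg.
have B0 : 0 <= B := le_trans (normr_ge0 _) (fB 0%N 0).
pose C := B / (1 - q^-1).
have step m n x : `|dilation_iter q f m x - dilation_iter q f (m + n)%N x| <=
    B * (geo (m + n).+1 - geo m.+1).
  elim: n => [|n IH]; first by rewrite addn0 !subrr mulr0 normr0.
  rewrite addnS /= opprD opprK addrA [geo _.+2]geoS [X in B * X]addrAC mulrDr.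
  rewrite (le_trans (ler_normD _ _))// lerD//.
  rewrite normrM (ger0_norm (exprV_ge0 _)).
  by rewrite mulrC exprVn ler_wpM2r//; exact: fB.
(* Let the second index of [step] tend to infinity; the geometric tail from m+1 on is at most
   q^-(m+1) / (1 - q^-1). *)
have rate m x : `|dilation_iter q f m x - g x| <= C * q^-1 ^+ m.+1.
  have : `|dilation_iter q f m x - dilation_iter q f n x| @[n --> \oo] -->
         `|dilation_iter q f m x - g x|.
    by apply: cvg_norm; apply: cvgB; [exact: cvg_cst|exact: fg].
  move/cvgr_to_le; apply; exists m => // n /= mn.
  rewrite -(subnKC mn) (le_trans (step _ _ _))// /C -mulrA ler_wpM2l//.
  rewrite /geo -mulrBl mulrC; apply: ler_wpM2l; first by rewrite invr_ge0 subr_ge0 ltW.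
  by have := exprn_ge0 (m + (n - m)).+1 invq_ge0; lra.
move=> U /uniform_nbhs[E [/=]].
rewrite -entourage_ballE => -[e /= e0 eE] EU.
have : C * q^-1 ^+ m.+1 @[m --> \oo] --> C * 0.
  apply: cvgM; first exact: cvg_cst.
  by rewrite (cvg_shiftS (fun n => q^-1 ^+ n)); apply: cvg_expr; rewrite ger0_norm.
rewrite mulr0 => /cvgr_lt /(_ _ e0) [N _ Ne].
exists N => // m Nm; apply: EU => x _; apply: eE.
by rewrite /= /ball /= distrC (le_lt_trans (rate m x))// Ne.
Qed.

(** Whichever uniform limit [get] selects, it is also the pointwise limit, and limits in [R] are
    unique. *)
Lemma dilation_productP f (g : R -> R) :
  {uniform, dilation_iter q f @ \oo --> g} -> dilation_product q f = g.
Proof.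
move=> fg; rewrite /dilation_product.
have fget := @getPex _ [set g : R -> R | {uniform, dilation_iter q f @ \oo --> g}]
  (ex_intro _ g fg).
have cv h x : {uniform, dilation_iter q f @ \oo --> h} ->
    dilation_iter q f m x @[m --> \oo] --> h x.
  move=> fh; have := @uniform_subset_cvg _ _ _ _ [set x] _ _ (@subsetT _ _) fh.
  by rewrite uniform_set1; apply.
by apply/funext => x; exact: (cvg_unique _ (cv _ _ fget) (cv _ _ fg)).
Qed.

Lemma expr_unbounded (a b : R) : 0 < a -> exists N, b <= a * q ^+ N.
Proof.
move=> a0.
have : b * q^-1 ^+ n @[n --> \oo] --> b * 0.
  by apply: cvgM; [exact: cvg_cst|apply: cvg_expr; rewrite ger0_norm].
rewrite mulr0 => /cvgr_lt /(_ _ a0) [N _ Ne]; exists N.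
by rewrite -ler_pdivrMr ?exprn_gt0// -exprVn ltW// Ne//=.
Qed.

End DilationProduct.

(** The partial sums are constant from L+1 on. This collapses the series of the theorem, since the
    shells (eps q^l, eps q^(l+1)] are disjoint. *)
Lemma lim_series_single (R : realType) (u : R ^nat) (L : nat) :
  (forall l, l != L -> u l = 0) -> limn (series u) = u L.
Proof.
move=> u0; apply/cvg_lim => //; apply: cvg_near_cst; exists L.+1 => // n /= Ln.
rewrite /series /= (bigD1_seq L) ?mem_index_iota ?iota_uniq//=.
by rewrite big1 ?addr0.
Qed.

Theorem theorem13 (R : realType) (q eps : R) (phi0 eta : R -> R) :
  1 < q -> 0 < eps ->
  smooth phi0 -> compactly_supported phi0 ->
  smooth_segment eps (q * eps) eta ->
  (forall x : R,
     phi0 x = if `|x| <= eps then 1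
              else if `|x| <= eps * q then eta `|x|
              else 0) ->
  {uniform, dilation_iter q phi0 @ \oo --> dilation_product q phi0} /\
  forall x : R,
    dilation_product q phi0 x =
      euler_function (1 / q) +
      limn (series (fun l : nat =>
        ((q_pochhammer q q l)^-1 * eta (`|x| / q ^+ l)
         - \sum_(0 <= k < l.+1) (q_pochhammer q q k)^-1)
        * \1_(`](eps * q ^+ l), (eps * q ^+ l.+1)]) `|x|)).
Proof.
move=> q1 eps0 sm _ _ phiE; have q0 : 0 < q := lt_trans ltr01 q1.
have e_le : eps <= eps * q by rewrite ler_peMr ?ltW.
have le_rad j k : (eps * q ^+ j <= eps * q ^+ k) = (j <= k)%N.
  by rewrite ler_pM2l// ler_eXn2l.
(* The extreme value theorem bounds [phi0] on [-eps q, eps q], and it vanishes elsewhere. *)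
have [M phiM] : exists M, forall x, `|phi0 x| <= M.
  have cphi : {within `[- (eps * q), eps * q], continuous (fun x => `|phi0 x|)}.
    apply: continuous_subspaceT => x; apply: cvg_norm.
    have := sm 0%N x; rewrite derive1n0 => /derivable1_diffP.
    exact: differentiable_continuous.
  have [|c cI cmax] := EVT_max _ cphi.
    by rewrite ge0_cp// (le_trans _ e_le)// ltW.
  exists `|phi0 c| => x; have [xI|xI] := leP `|x| (eps * q).
    by apply: cmax; rewrite in_itv/= -ler_norml.
  rewrite phiE (lt_geF (le_lt_trans e_le xI)) (lt_geF xI) normr0.
  exact: normr_ge0.
have normE x j : `|x / q ^+ j| = `|x| / q ^+ j.
  by rewrite normrM normfV [`|q ^+ j|]ger0_norm// exprn_ge0// ltW.
have phi1 x N : `|x| <= eps * q ^+ N -> forall j, (N <= j)%N -> phi0 (x / q ^+ j) = 1.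
  move=> xN j Nj; rewrite phiE normE ler_pdivrMr ?exprn_gt0// ifT//.
  by rewrite (le_trans xN)// le_rad.
pose psi x := lim (dilation_iter q phi0 m x @[m --> \oo]).
have cpsi x : dilation_iter q phi0 m x @[m --> \oo] --> psi x.
  have [N xN] := expr_unbounded q1 `|x| eps0.
  by apply: cvgP; apply: (cvg_dilation_iter q1); exact: phi1 xN.
have upsi := uniform_dilation_iter q1 phiM cpsi.
rewrite (dilation_productP upsi); split => // x.
(* The least N locates x: N = 0 means |x| <= eps, outside every shell, while N = L+1 puts |x| in
   shell L. *)
have [N xN Nmin] := ex_minnP (expr_unbounded q1 `|x| eps0).
rewrite /psi; have /cvg_lim -> // := cvg_dilation_iter q1 (phi1 _ _ xN).
congr (_ + _); case: N xN Nmin => [|L] xL Lmin.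
  rewrite big_nil -[LHS](@lim_series_single R (fun=> 0) 0%N)//.
  congr (limn (series _)); apply/funext => l.
  rewrite indicE memNset ?mulr0//= in_itv/= => /andP[/lt_geF + _].
  by rewrite (le_trans xL)// le_rad.
have Lx : eps * q ^+ L < `|x| by rewrite ltNge; apply/negP => /Lmin; rewrite ltnn.
rewrite (@lim_series_single _ _ L) => [|l lL]; last first.
  rewrite indicE memNset ?mulr0//= in_itv/= => /andP[lx xl].
  move: lL; rewrite neq_ltn -!le_rad => /orP[lL|Ll].
    by have := le_lt_trans lL Lx; rewrite ltNge xl.
  by have := le_lt_trans Ll lx; rewrite ltNge xL.
rewrite indicE mem_set ?mulr1/=; last by rewrite in_itv/= Lx.
under eq_bigr do rewrite mulrBr mulr1.
rewrite sumrB; congr (_ - _).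
(* Only j = L survives: there |x| / q^L lies in (eps, eps q], where [phi0] is given by [eta]; for j
   < L, |x| / q^j exceeds eps q, so [phi0] vanishes. *)
rewrite big_nat_recr//= big_nat big1 ?add0r => [|j /andP[_ jL]].
  rewrite phiE normE ler_pdivrMr ?exprn_gt0// (lt_geF Lx).
  by rewrite ler_pdivrMr ?exprn_gt0// -mulrA -exprS xL.
rewrite phiE normE !ler_pdivrMr ?exprn_gt0// -mulrA -exprS.
have jx : eps * q ^+ j.+1 < `|x|.
  by rewrite (le_lt_trans _ Lx)// le_rad.
rewrite (lt_geF jx) lt_geF ?mulr0//.
by rewrite (le_lt_trans _ jx)// le_rad.
Qed.
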